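(* If $\beta\in B_n$ and $L$ is the closure of $\beta$, then $t_n^{\dagger\dagger}(\beta)=a^{\#L}$ in $S^{\dagger\dagger}$, where $\#L$ denotes the number of components of the link $L$.
   Context: $B_n$ is the braid group on $n$ strands with Artin generators $s_1,\dots,s_{n-1}$. $S^{\dagger\dagger}=\mathbb{Q}[a,b,c,(abc)^{-1},(b+c)^{-1}]/(a^2-1,bc-1)$, so $a^2=1$ in $S^{\dagger\dagger}$. $t_n^{\dagger\dagger}$ is the Markov trace defined on braids by $t_n^{\dagger\dagger}(\beta)=a^n\psi_n(\beta)$, where $\psi_n$ is the multiplicative map defined by $\psi_n(s_i)=a$ for all $i$. *)

(* Defs.v *)
From HB Require Import structures.
From mathcomp Require Import all_boot all_order all_algebra.
From mathcomp Require Import generic_quotient ring_quotient boolp.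
From mathcomp Require mpoly.
From mathcomp Require ring.
Import Order.TTheory GRing.Theory Num.Theory.

Set Implicit Arguments.
Unset Strict Implicit.
Unset Printing Implicit Defensive.

(* The ring S = Q[a,b,c,(abc)^-1,(b+c)^-1]/(a^2-1, bc-1).  The localization is
   presented by two extra variables standing for the adjoined inverses:
   S = Q[a,b,c,u,v]/(abc u - 1, (b+c) v - 1, a^2 - 1, bc - 1). *)

Module CoefRing.

Import mpoly ring.
Local Open Scope ring_scope.

Definition P : comNzRingType := {mpoly rat[5]}.

Definition var (k : nat) : P := 'X_(inord k : 'I_5).
Definition xa := var 0.
Definition xb := var 1.
Definition xc := var 2.
Definition xu := var 3.
Definition xv := var 4.

Definition ideal : P -> bool := fun p =>
  `[< exists f1 f2 f3 f4 : P,
        p = f1 * (xa * xb * xc * xu - 1) + f2 * ((xb + xc) * xv - 1)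
          + f3 * (xa ^+ 2 - 1) + f4 * (xb * xc - 1) >].

(* The point a = b = c = u = 1, v = 1/2 shows that the ideal is proper. *)
Definition pt (i : 'I_5) : rat := if (i : nat) == 4 then 2^-1 else 1.

Definition evalP : {rmorphism P -> rat} := mmap (@idfun rat) pt.

Lemma eval_var k : (k < 5)%N -> evalP (var k) = if k == 4 then 2^-1 else 1.
Proof. by move=> k5; rewrite /evalP /var /= mmapX mmap1U /pt inordK. Qed.

Lemma ideal_closed : idealr_closed ideal.
Proof.
split.
- by apply/asboolP; exists 0, 0, 0, 0; rewrite !mul0r !addr0.
- apply/negP => /asboolP[f1 [f2 [f3 [f4]]]].
  move=> /(congr1 evalP).
  have [ea eb ec] : [/\ evalP xa = 1, evalP xb = 1 & evalP xc = 1].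
    by split; rewrite eval_var.
  have [eu ev] : evalP xu = 1 /\ evalP xv = 2^-1 by split; rewrite eval_var.
  rewrite !(rmorphD, rmorphM, rmorphN, rmorphXn, rmorph1) ea eb ec eu ev.
  rewrite (_ : (1 + 1) / 2 = 1) // !mulr1 expr1n subrr !mulr0 !addr0.
  by move/eqP; rewrite oner_eq0.
- move=> p x y /asboolP[f1 [f2 [f3 [f4 ->]]]] /asboolP[g1 [g2 [g3 [g4 ->]]]].
  apply/asboolP.
  exists (p * f1 + g1), (p * f2 + g2), (p * f3 + g3), (p * f4 + g4).
  ring.
Qed.

HB.instance Definition _ := isIdealr.Build P ideal ideal_closed.

Definition idealI : idealr P := ideal.

Local Open Scope quotient_scope.

Definition S : comNzRingType := {ideal_quot idealI}.

Definition cls : {rmorphism P -> S} := \pi_({ideal_quot idealI}).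

Definition a : S := cls xa.
Definition b : S := cls xb.
Definition c : S := cls xc.
Definition abcV : S := cls xu.
Definition bcV : S := cls xv.

Lemma clsE (p q : P) : cls p = cls q <-> ideal (p - q).
Proof.
split; first by move=> /eqP; rewrite -Quotient.idealrBE.
by move=> Ipq; apply/eqP; rewrite -Quotient.idealrBE.
Qed.

Lemma cls_relation (p : P) : ideal (p - 1) -> cls p = 1.
Proof. by move=> Ip; rewrite -(rmorph1 cls); apply/clsE. Qed.

Lemma abcK : a * b * c * abcV = 1.
Proof.
rewrite -!rmorphM; apply/cls_relation/asboolP; exists 1, 0, 0, 0; ring.
Qed.

Lemma bcDK : (b + c) * bcV = 1.
Proof.
rewrite -rmorphD -rmorphM; apply/cls_relation/asboolP; exists 0, 1, 0, 0; ring.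
Qed.

Lemma sqra : a ^+ 2 = 1.
Proof.
rewrite -rmorphXn; apply/cls_relation/asboolP; exists 0, 0, 1, 0; ring.
Qed.

Lemma bcK : b * c = 1.
Proof.
rewrite -rmorphM; apply/cls_relation/asboolP; exists 0, 0, 0, 1; ring.
Qed.

(* The inverse of a, as it exists already before imposing a^2 = 1. *)
Definition aV : S := b * c * abcV.

Lemma aVK : a * aV = 1.
Proof. by rewrite /aV !mulrA abcK. Qed.

End CoefRing.

From mathcomp Require Import finmap.
From mathcomp Require Import all_classical all_reals all_analysis.
Import numFieldNormedType.Exports.

(* The braid group on n strands, by Artin's presentation.  Generators are
   indexed from 0; the letter (i, true) is s_i and (i, false) is s_i^-1. *)

Definition bword (n : nat) : Type := seq ('I_n.-1 * bool).
HB.instance Definition _ n := Choice.on (bword n).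

Inductive braid_rel (n : nat) : bword n -> bword n -> Prop :=
| braid_refl w : braid_rel w w
| braid_sym w1 w2 : braid_rel w1 w2 -> braid_rel w2 w1
| braid_trans w1 w2 w3 : braid_rel w1 w2 -> braid_rel w2 w3 -> braid_rel w1 w3
| braid_cat u v w1 w2 :
    braid_rel w1 w2 -> braid_rel (u ++ w1 ++ v) (u ++ w2 ++ v)
| braid_cancel i e : braid_rel [:: (i, e); (i, ~~ e)] [::]
| braid_far (i j : 'I_n.-1) : (i.+1 < j)%N ->
    braid_rel [:: (i, true); (j, true)] [:: (j, true); (i, true)]
| braid_artin (i j : 'I_n.-1) : j = i.+1 :> nat ->
    braid_rel [:: (i, true); (j, true); (i, true)]
              [:: (j, true); (i, true); (j, true)].

Section BraidGroup.

Variable n : nat.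
Implicit Types u v w : bword n.

Definition braid_relb u v : bool := `[< braid_rel u v >].

Lemma braid_relb_refl : reflexive braid_relb.
Proof. by move=> u; apply/asboolP; exact: braid_refl. Qed.

Lemma braid_relb_sym : symmetric braid_relb.
Proof.
by move=> u v; apply/asboolP/asboolP => h; exact: braid_sym.
Qed.

Lemma braid_relb_trans : transitive braid_relb.
Proof.
move=> v u w /asboolP uv /asboolP vw; apply/asboolP; exact: braid_trans uv vw.
Qed.

Canonical braid_equiv :=
  EquivRel braid_relb braid_relb_refl braid_relb_sym braid_relb_trans.

Local Open Scope quotient_scope.

Definition braid := {eq_quot braid_equiv}.
HB.instance Definition _ := Choice.on braid.
HB.instance Definition _ := EqQuotient.on braid.

Definition bclass (w : bword n) : braid := \pi_braid w.

Lemma bclassP u v : bclass u = bclass v <-> braid_rel u v.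
Proof. by split => [/eqmodP/asboolP|h] //; apply/eqmodP/asboolP. Qed.

Lemma bclassK (x : braid) : bclass (repr x) = x.
Proof. exact: reprK. Qed.

Lemma repr_bclass w : braid_rel (repr (bclass w)) w.
Proof. by apply/bclassP; rewrite bclassK. Qed.

Lemma braid_cat2 u1 u2 v1 v2 : braid_rel u1 u2 -> braid_rel v1 v2 ->
  braid_rel (u1 ++ v1) (u2 ++ v2).
Proof.
move=> hu hv; apply: (@braid_trans _ _ (u2 ++ v1)).
  exact: (braid_cat [::] v1 hu).
by have := braid_cat u2 [::] hv; rewrite !cats0.
Qed.

Definition winv w : bword n := rev [seq (l.1, ~~ l.2) | l <- w].

Lemma winvKl w : braid_rel (winv w ++ w) [::].
Proof.
elim: w => [|[i e] w IH]; first exact: braid_refl.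
rewrite /winv /= rev_cons -cats1 -catA /=.
apply: braid_trans IH; rewrite -[X in braid_rel _ X]/(_ ++ [::] ++ w).
have := braid_cat (winv w) w (braid_cancel i (~~ e)).
by rewrite negbK.
Qed.

Lemma winvKr w : braid_rel (w ++ winv w) [::].
Proof.
elim: w => [|[i e] w IH]; first exact: braid_refl.
rewrite /winv /= rev_cons -cats1 -/(winv w) catA.
apply: braid_trans (braid_cancel i e).
exact: (braid_cat [:: (i, e)] [:: (i, ~~ e)] IH).
Qed.

Definition bone : braid := bclass [::].
Definition bmul (x y : braid) : braid := bclass (repr x ++ repr y).
Definition binv (x : braid) : braid := bclass (winv (repr x)).

Lemma bmulE u v : bmul (bclass u) (bclass v) = bclass (u ++ v).
Proof. by apply/bclassP; apply: braid_cat2; exact: repr_bclass. Qed.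

Lemma bmulA : associative bmul.
Proof.
move=> x y z; rewrite -(bclassK x) -(bclassK y) -(bclassK z).
by rewrite !bmulE catA.
Qed.

Lemma bmul1 : left_id bone bmul.
Proof. by move=> x; rewrite -(bclassK x) bmulE. Qed.

Lemma bmulr1 : right_id bone bmul.
Proof. by move=> x; rewrite -(bclassK x) bmulE cats0. Qed.

Lemma bmulV : left_inverse bone binv bmul.
Proof.
move=> x; rewrite -{2}(bclassK x) bmulE; apply/bclassP; exact: winvKl.
Qed.

Lemma bmulrV : right_inverse bone binv bmul.
Proof.
move=> x; rewrite -{1}(bclassK x) bmulE; apply/bclassP; exact: winvKr.
Qed.

HB.instance Definition _ :=
  isGroup.Build braid bmulA bmul1 bmulr1 bmulV bmulrV.

Definition gen (i : 'I_n.-1) : braid := bclass [:: (i, true)].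

Lemma bclassD u v : bclass (u ++ v) = (bclass u * bclass v)%g.
Proof. by rewrite -[RHS]/(bmul _ _) bmulE. Qed.

Lemma bclass_gen i : bclass [:: (i, true)] = gen i.
Proof. by []. Qed.

Lemma bclass_genV i : bclass [:: (i, false)] = (gen i)^-1%g.
Proof.
apply: (@mulgI _ (gen i)); rewrite mulgV -bclassD.
by apply/bclassP; exact: braid_cancel.
Qed.

Local Open Scope ring_scope.
Import CoefRing.

Definition psi_word w : S := \prod_(l <- w) (if l.2 then a else aV).

Lemma psi_word_rel u v : braid_rel u v -> psi_word u = psi_word v.
Proof.
rewrite /psi_word.
elim=> {u v} //= [w1 w2 w3 _ -> _ -> //|u v w1 w2 _ h|i [] |i j _|i j _].
- by rewrite !big_cat /= h.
- by rewrite !big_cons big_nil /= mulr1 aVK.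
- by rewrite !big_cons big_nil /= mulr1 mulrC aVK.
- by rewrite !big_cons.
- by rewrite !big_cons.
Qed.

Definition psi (x : braid) : S := psi_word (repr x).

Lemma psi_bclass w : psi (bclass w) = psi_word w.
Proof. exact/psi_word_rel/repr_bclass. Qed.

Lemma psi1 : psi 1%g = 1.
Proof. by rewrite -[1%g]/(bclass [::]) psi_bclass /psi_word big_nil. Qed.

Lemma psiM (x y : braid) : psi (x * y)%g = psi x * psi y.
Proof.
by rewrite -(bclassK x) -(bclassK y) -bclassD !psi_bclass /psi_word big_cat.
Qed.

Lemma psi_gen i : psi (gen i) = a.
Proof. by rewrite psi_bclass /psi_word big_seq1. Qed.

Lemma psi_unique (f : braid -> S) :
    f 1%g = 1 -> (forall x y, f (x * y)%g = f x * f y) ->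
    (forall i, f (gen i) = a) -> f =1 psi.
Proof.
move=> f1 fM fg x; rewrite -(bclassK x); elim: (repr x) => [|[i e] w IH].
  by rewrite -[bclass [::]]/(1%g : braid) f1 psi1.
rewrite -cat1s bclassD fM psiM IH; congr (_ * _).
case: e; first by rewrite bclass_gen fg psi_gen.
rewrite psi_bclass /psi_word big_seq1 /= bclass_genV.
by rewrite -[LHS]mul1r -aVK mulrAC mulrC -(fg i) -fM mulgV f1 mulr1.
Qed.

Definition markov_trace (x : braid) : S := a ^+ n * psi x.

End BraidGroup.

(* Links are subsets of R^3. *)

Section Closure.

Variable R : realType.
Local Open Scope ring_scope.
Local Open Scope classical_set_scope.

Local Notation R3 := (R * R * R)%type.

Definition cylindrical (theta r z : R) : R3 := (r * cos theta, r * sin theta, z).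

(* The strand starting in position j (counted from 0, placed at distance j + 1
   from the axis), over one elementary piece of a braid parametrised by t in
   [0, 1]; the result is the pair (distance to the axis, height).  [None] is
   the trivial piece; on the piece s_i^e the strands in positions i and i + 1
   are exchanged, one passing above the other according to the sign e. *)
Definition strand (n : nat) (l : option ('I_n.-1 * bool)) (j : 'I_n) (t : R) : R * R :=
  if l is Some (i, e) then
    let h := (if e then 1 else -1) * (t * (1 - t)) in
    if j == i :> nat then (i.+1%:R + t, h)
    else if j == i.+1 :> nat then (i.+2%:R - t, - h)
    else (j.+1%:R, 0)
  else (j.+1%:R, 0).

(* The braid spelled by w, wrapped once around the z-axis.  The turn is divided
   into (size w).+1 equal sectors: one for each letter, and a last one, where
   [onth w k] is [None], in which the strands close up trivially. *)
Definition closed_braid (n : nat) (w : bword n) : set R3 :=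
  [set p | exists (k : nat) (j : 'I_n) (t : R),
     [/\ (k <= size w)%N, 0 <= t <= 1 &
         p = cylindrical (2 * pi * ((k%:R + t) / (size w).+1%:R))
               (strand (onth w k) j t).1 (strand (onth w k) j t).2]].

Definition homeomorphism (T U : topologicalType) (f : T -> U) : Prop :=
  continuous f /\
  exists g : U -> T, [/\ continuous g, cancel f g & cancel g f].

Definition ambient_isotopic (A B : set R3) : Prop :=
  exists H : R * R3 -> R3,
    [/\ {within `[0, 1] `*` setT, continuous H},
        forall t, t \in `[0, 1] -> homeomorphism (fun x : R3 => H (t, x)),
        forall x, H (0, x) = x &
        (fun x => H (1, x)) @` A = B].

(* A link is considered up to ambient isotopy. *)
Definition is_closure (n : nat) (beta : braid n) (L : set R3) : Prop :=
  exists w : bword n, bclass w = beta /\ ambient_isotopic (closed_braid w) L.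

Definition components (L : set R3) : set (set R3) :=
  [set connected_component L x | x in L].

Definition n_components (L : set R3) : nat := #|` fset_set (components L)|%fset.

End Closure.

(* Main.v *)
(* Cut the closed braid into arcs, one for each sector and position.  Following
   the arcs around the axis shows that those labelled by a given cycle of the
   underlying permutation form a connected compact set; sets of different cycles
   are disjoint, because two strands never meet at the same angle.  A
   homeomorphism preserves all this, so #L is the number of cycles.  Each letter
   acts as a transposition, so the sign of the permutation gives
   size w = n - #L mod 2, and a^2 = 1 does the rest. *)
Require Import Defs.
From HB Require Import structures.
From mathcomp Require Import all_boot all_order all_algebra.
From mathcomp Require Import all_fingroup finmap lra.
From mathcomp Require Import all_classical all_reals all_analysis.
Import GRing.Theory Num.Theory Order.TTheory.
Import numFieldNormedType.Exports.

Set Implicit Arguments.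
Unset Strict Implicit.
Unset Printing Implicit Defensive.

Local Open Scope ring_scope.
Local Open Scope classical_set_scope.

(** * Powers of [a] in the coefficient ring *)

Lemma coef_aV : CoefRing.aV = CoefRing.a.
Proof.
by rewrite -[LHS]mul1r -CoefRing.sqra expr2 -mulrA CoefRing.aVK mulr1.
Qed.

Lemma coef_a_odd (k : nat) : CoefRing.a ^+ k = CoefRing.a ^+ odd k.
Proof.
rewrite -{1}(odd_double_half k) exprD -mul2n exprM CoefRing.sqra expr1n.
by rewrite mulr1.
Qed.

(** Since [a] is its own inverse, positive and negative letters contribute the same factor. *)
Lemma psi_wordE n (w : bword n) : psi_word w = CoefRing.a ^+ size w.
Proof.
rewrite /psi_word; elim: w => [|[i e] w IH]; first by rewrite big_nil.
by rewrite big_cons IH exprS coef_aV if_same.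
Qed.

(** * The permutation underlying a braid word *)

Lemma ltn_lo n (i : 'I_n.-1) : (i < n)%N.
Proof. by case: n i => [|n] [i] //= /ltnW. Qed.

Lemma ltn_hi n (i : 'I_n.-1) : (i.+1 < n)%N.
Proof. by case: n i => [|n] [i]. Qed.

Definition letter_swap n (i : 'I_n.-1) : 'S_n :=
  tperm (Ordinal (ltn_lo i)) (Ordinal (ltn_hi i)).

Definition piece_perm n (l : option ('I_n.-1 * bool)) : 'S_n :=
  if l is Some le then letter_swap le.1 else 1%g.

(** Products in ['S_n] apply the left factor first, so this sends the initial position of a strand
    to its final one. *)
Definition word_perm n (w : bword n) : 'S_n :=
  (\prod_(l <- w) letter_swap l.1)%g.

(** Past the end of [w] the prefix stops growing and [onth] gives [None], whose piece acts
    trivially. The closing sector can thus be treated like a letter. *)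
Lemma word_perm_take n (w : bword n) k :
  word_perm (take k.+1 w) =
  (word_perm (take k w) * piece_perm (onth w k))%g.
Proof.
rewrite /word_perm; elim: w k => [|l w IH] [|k] //=.
- by rewrite big_nil mulg1.
- by rewrite big_nil mulg1.
- by rewrite take0 big_seq1 big_nil mul1g.
- by rewrite !big_cons IH mulgA.
Qed.

Lemma odd_word_perm n (w : bword n) :
  odd_perm (word_perm w) = odd (size w).
Proof.
rewrite /word_perm; elim: w => [|l w IH]; first by rewrite big_nil odd_perm1.
rewrite big_cons odd_permM IH odd_tperm /=.
by rewrite -val_eqE /= neq_ltn ltnSn.
Qed.

Lemma markov_traceE n (w : bword n) :
  markov_trace (bclass w) = CoefRing.a ^+ #|porbits (word_perm w)|.
Proof.
rewrite /markov_trace psi_bclass psi_wordE -exprD coef_a_odd [RHS]coef_a_odd.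
congr (_ ^+ (nat_of_bool _)); have := odd_word_perm w.
(* [odd_perm] is by definition the parity of [n] plus that of the number of cycles, so the two
   copies of [odd n] cancel. *)
by rewrite oddD /odd_perm card_ord => <-; rewrite addKb.
Qed.

(** * Components of a finite disjoint union *)

Lemma components_disjoint_closed (T : topologicalType) (I : finType)
    (D : {set I}) (F : I -> set T) :
    {in D, forall i, closed (F i)} -> {in D, forall i, connected (F i)} ->
    {in D &, forall i j x, F i x -> F j x -> i = j} ->
  {in D, forall i x, F i x ->
    connected_component (\bigcup_(i in [set` D]) F i) x = F i}.
Proof.
move=> Fcl Fco Fdis i iD x Fix; apply/seteqP; split; last first.
  by apply: connected_component_max (Fco _ iD) => // y Fiy; exists i.
move=> y [B [Bx BX Bc] By].
suff E : B `&` F i = B by move: By; rewrite -E => -[].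
(* The union of the other pieces is closed, so F i is clopen in the total. *)
pose G := \bigcup_(j in [set` D :\ i]) F j.
apply: Bc; [by exists x| |by exists (F i) => //; exact: Fcl].
exists (~` G).
  apply: closed_openC; rewrite /G bigcup_pred -big_filter.
  apply: closed_bigsetU => j; rewrite mem_filter => /andP[jD _].
  by apply: Fcl; move: jD; rewrite !inE => /andP[].
apply/seteqP; split => z [Bz].
  move=> Fiz; split=> // -[j /=]; rewrite !inE => /andP[ji jD] Fjz.
  by move/eqP: ji; apply; apply: (Fdis _ _ jD iD z).
have [j jD Fjz] := BX _ Bz; move=> nG; split => //.
have [<-//|ji] := eqVneq j i.
by case: nG; exists j => //=; rewrite !inE ji.
Qed.

(** For [y <= x] let [e] be half of [x - y]. Then [cos (x - y) = 1] forces [sin e = 0], while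
    [0 <= e < pi] and [sin] is positive on []0, pi[]. *)
Lemma sincos_inj (R : realType) (x y : R) :
    0 <= x < 2 * pi -> 0 <= y < 2 * pi ->
  cos x = cos y -> sin x = sin y -> x = y.
Proof.
wlog xy : x y / y <= x.
  move=> H hx hy hc hs; have [?|/ltW ?] := leP y x; first exact: H.
  by apply/esym/H.
move=> /andP[x0 x2] /andP[y0 y2] hc hs.
pose e := (x - y) / 2.
have exy : x - y = e *+ 2 by rewrite /e; lra.
have : cos (x - y) = 1 by rewrite cosB hc hs -!expr2 cos2Dsin2.
rewrite exy cos_mulr2n cos2sin2 => h.
have s0 : sin e = 0 by apply/eqP; rewrite -sqrf_eq0; apply/eqP; lra.
have [e0|e0] := ltP 0 e; last by rewrite /e in e0; lra.
have : 0 < sin e by apply: sin_gt0_pi; rewrite e0 /e; lra.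
by rewrite s0 ltxx.
Qed.

Lemma card_components (T : topologicalType) (I : finType)
    (D : {set I}) (F : I -> set T) :
    {in D, forall i, closed (F i)} -> {in D, forall i, connected (F i)} ->
    {in D &, forall i j x, F i x -> F j x -> i = j} ->
    {in D, forall i, F i !=set0} ->
  #|` fset_set [set connected_component (\bigcup_(i in [set` D]) F i) x
               | x in \bigcup_(i in [set` D]) F i]|%fset = #|D|.
Proof.
move=> Fcl Fco Fdis Fne.
(* [fset_set] is empty on infinite sets, so the set of components is first exhibited as a finite
   one. *)
have -> : [set connected_component (\bigcup_(i in [set` D]) F i) x
          | x in \bigcup_(i in [set` D]) F i]
        = [set` [fset F i | i in enum D]%fset].
  apply/seteqP; split => A /=.
    move=> [x [i iD Fix] <-].
    rewrite (components_disjoint_closed Fcl Fco Fdis iD Fix).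
    by apply: in_imfset; rewrite /= mem_enum.
  move=> /imfsetP[i /=]; rewrite mem_enum => iD ->; have [x Fix] := Fne _ iD.
  by exists x; [exists i|exact: (components_disjoint_closed Fcl Fco Fdis iD Fix)].
rewrite set_fsetK card_in_imfset /=.
  by rewrite undup_id ?enum_uniq // cardE.
(* Nonempty disjoint pieces with distinct indices are distinct sets. *)
move=> i j /=; rewrite !mem_enum => iD jD Fij.
have [x Fix] := Fne _ iD; apply: (Fdis _ _ iD jD x) => //.
by rewrite -Fij.
Qed.

Lemma continuous_pairing (T U V : topologicalType) (f : T -> U) (g : T -> V)
    (x : T) :
  {for x, continuous f} -> {for x, continuous g} ->
  {for x, continuous (fun y => (f y, g y))}.
Proof. by move=> cf cg; exact: (cvg_pair cf cg). Qed.

(** * Strands and arcs in cylindrical coordinates *)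

Section ClosedBraid.

Variables (R : realType) (n : nat).
Implicit Types (w : bword n) (j : 'I_n) (l : option ('I_n.-1 * bool)).

Lemma strand0 l j : strand l j (0 : R) = (j.+1%:R, 0).
Proof.
case: l => [[i e]|] //=.
by do 2?[case: eqP => [->|_]]; rewrite ?mul0r ?mulr0 ?oppr0 ?addr0 ?subr0.
Qed.

Lemma strand1 l j : strand l j (1 : R) = ((piece_perm l j).+1%:R, 0).
Proof.
case: l => [[i e]|]; last by rewrite /= perm1.
rewrite /= /letter_swap; case: tpermP => [->|->|/eqP ji /eqP ji1] /=.
- by rewrite eqxx subrr !mulr0 natr1.
- by rewrite gtn_eqF // eqxx subrr !mulr0 oppr0 -natr1 addrK.
- move: ji ji1; rewrite -!val_eqE /= => ji ji1.
  by rewrite (negbTE ji) (negbTE ji1).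
Qed.

Lemma strand_gt0 l j (t : R) : 0 <= t <= 1 -> 0 < (strand l j t).1.
Proof.
move=> /andP[t0 t1]; case: l => [[i e]|] /=; rewrite ?ltr0Sn //.
case: ifP => _ /=; first by rewrite ltr_wpDr.
case: ifP => _ /=; last by rewrite ltr0Sn.
by rewrite -natr1; have : 0 < i.+1%:R :> R by []; lra.
Qed.

(** The two exchanged strands have equal distances only at [t = 1/2], where their heights are
    opposite and nonzero. The others keep distinct distances outside [[i + 1, i + 2]]. *)
Lemma strand_inj l (t : R) : 0 <= t <= 1 ->
  injective (fun j => strand l j t).
Proof.
move=> /andP[t0 t1] j j'; case: l => [[i e]|] /=; last first.
  by move=> [] /eqP; rewrite eqr_nat eqSS => /eqP /val_inj.
have i2 : i.+2%:R = i.+1%:R + 1 :> R by rewrite natr1.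
have far (k : nat) : (k == i :> nat) = false -> (k == i.+1 :> nat) = false ->
    k.+1%:R < i.+1%:R :> R \/ i.+1%:R + 1 < k.+1%:R :> R.
  move=> /negbT ki /negbT ki1; rewrite natr1 !ltr_nat !ltnS.
  case: (ltngtP k i) ki => // + _; first by left.
  by rewrite leq_eqVlt eq_sym (negbTE ki1); right.
(* The heights of the exchanged strands vanish only at the two ends, where their distances
   differ. *)
have half : 0 < t * (1 - t) \/ t * (1 - t) = 0 /\ (t = 0 \/ t = 1).
  have [->|tn0] := eqVneq t 0; first by right; rewrite mul0r; auto.
  have [->|tn1] := eqVneq t 1; first by right; rewrite subrr mulr0; auto.
  by left; apply: mulr_gt0; rewrite ?subr_gt0 lt_neqAle ?tn1 ?t1 // eq_sym tn0.
case: (j =P i :> nat) => [ji|/eqP/negbTE ji];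
  case: (j' =P i :> nat) => [j'i|/eqP/negbTE j'i].
- by move=> _; apply/val_inj; rewrite /= ji.
- case: (j' =P i.+1 :> nat) => [j'i1|/eqP/negbTE j'i1] [].
    move=> h1 h2; exfalso; move: h1 h2.
    by case: e; case: half => [?|[? [?|?]]]; lra.
  by move=> h _; exfalso; have [] := far _ j'i j'i1; lra.
- case: (j =P i.+1 :> nat) => [ji1|/eqP/negbTE ji1] [].
    move=> h1 h2; exfalso; move: h1 h2.
    by case: e; case: half => [?|[? [?|?]]]; lra.
  by move=> h _; exfalso; have [] := far _ ji ji1; lra.
case: (j =P i.+1 :> nat) => [ji1|/eqP/negbTE ji1];
  case: (j' =P i.+1 :> nat) => [j'i1|/eqP/negbTE j'i1].
- by move=> _; apply/val_inj; rewrite /= ji1.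
- by move=> [h _]; exfalso; have [] := far _ j'i j'i1; lra.
- by move=> [h _]; exfalso; have [] := far _ ji ji1; lra.
by move=> [] /eqP; rewrite eqr_nat eqSS => /eqP /val_inj.
Qed.

Lemma strand_continuous l j : continuous (@strand R n l j).
Proof.
case: l => [[i e]|] /=; last exact: cst_continuous.
have t1t : continuous (fun t : R => (if e then 1 else -1) * (t * (1 - t))).
  move=> t; apply: cvgM; first exact: cvg_cst.
  by apply: cvgM => //; apply: cvgB => //; exact: cvg_cst.
rewrite /strand.
case: (j == i :> nat); last case: (j == i.+1 :> nat); last exact: cst_continuous.
  move=> t; apply: continuous_pairing => /=; last exact: t1t.
  by apply: cvgD => //; exact: cvg_cst.
move=> t; apply: (@continuous_pairing _ _ _ (fun t : R => i.+2%:R - t)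
  (fun t : R => - ((if e then 1 else -1) * (t * (1 - t))))); last first.
  by apply: cvgN; exact: t1t.
by apply: cvgB => //; exact: cvg_cst.
Qed.

(** No bound is put on [k], so that the end of the closing sector is also the start of sector
    [(size w).+1]. *)
Definition arc w (k : nat) j (t : R) : R * R * R :=
  cylindrical (2 * pi * ((k%:R + t) / (size w).+1%:R))
    (@strand R n (onth w k) j t).1 (@strand R n (onth w k) j t).2.

Lemma arc_continuous w k j : continuous (arc w k j).
Proof.
move=> t.
have ct := @strand_continuous (onth w k) j t.
have c1 : (strand (onth w k) j x).1 @[x --> t] --> (strand (onth w k) j t).1.
  by apply: (cvg_comp _ _ ct); exact: cvg_fst.
have c2 : (strand (onth w k) j x).2 @[x --> t] --> (strand (onth w k) j t).2.
  by apply: (cvg_comp _ _ ct); exact: cvg_snd.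
have ca : 2 * pi * ((k%:R + x) / (size w).+1%:R) @[x --> t] -->
    2 * pi * ((k%:R + t) / (size w).+1%:R).
  apply: cvgM; first exact: cvg_cst.
  apply: cvgM; last exact: cvg_cst.
  by apply: cvgD => //; exact: cvg_cst.
pose r (s : R) := (strand (onth w k) j s).1.
pose th (s : R) := 2 * pi * ((k%:R + s) / (size w).+1%:R).
have cx : {for t, continuous (fun s : R => r s * cos (th s))}.
  by apply: cvgM => //; apply: (cvg_comp _ _ ca); exact: continuous_cos.
have cy : {for t, continuous (fun s : R => r s * sin (th s))}.
  by apply: cvgM => //; apply: (cvg_comp _ _ ca); exact: continuous_sin.
exact: continuous_pairing (continuous_pairing cx cy) c2.
Qed.

Lemma arc_next w k j : arc w k j 1 = arc w k.+1 (piece_perm (onth w k) j) 0.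
Proof. by rewrite /arc strand1 strand0 addr0 natr1. Qed.

Lemma arc_turn w j : arc w (size w).+1 j 0 = arc w 0 j 0.
Proof.
rewrite /arc !strand0 !addr0 mul0r divff ?pnatr_eq0 // mulr1 mulr0 /=.
by rewrite /cylindrical (mulr_natl pi 2) cos2pi sin2pi cos0 sin0.
Qed.

(** A point determines its positive radius, then its angle in [[0, 2 * pi[], hence [k + t], whose
    integer part is [k]; [strand_inj] then recovers [j]. Excluding [t = 1] avoids the ends shared by
    consecutive arcs. *)
Lemma arc_inj w k k' j j' (t t' : R) :
    (k <= size w)%N -> 0 <= t < 1 -> (k' <= size w)%N -> 0 <= t' < 1 ->
  arc w k j t = arc w k' j' t' -> k = k' /\ j = j'.
Proof.
move=> kw t01 k'w t'01 [].
set x := 2 * pi * ((k%:R + t) / _); set x' := 2 * pi * ((k'%:R + t') / _).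
set r := (strand (onth w k) j t).1; set r' := (strand (onth w k') j' t').1.
move=> hc hs hz.
have bound (i : nat) (s : R) : (i <= size w)%N -> 0 <= s < 1 ->
    0 <= 2 * pi * ((i%:R + s) / (size w).+1%:R) < 2 * pi.
  move=> iw /andP[s0 s1]; have pi0 := pi_gt0 R.
  rewrite mulr_ge0 ?divr_ge0 ?addr_ge0 ?mulr_ge0 ?pi_ge0 //=.
  rewrite gtr_pMr ?mulr_gt0 // ltr_pdivrMr ?ltr0Sn // mul1r -natr1.
  by apply: ler_ltD => //; rewrite ler_nat.
have le01 (s : R) : 0 <= s < 1 -> 0 <= s <= 1 by move=> /andP[-> /ltW].
have r0 : 0 < r by apply: strand_gt0; exact: le01.
have r'0 : 0 < r' by apply: strand_gt0; exact: le01.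
have rr' : r = r'.
  apply/eqP; rewrite -(@eqrXn2 _ 2) ?ltW //; apply/eqP.
  (* The squared radius is the sum of the squares of the first two coordinates. *)
  rewrite -[LHS]mulr1 -(cos2Dsin2 x) mulrDr -!exprMn hc hs !exprMn -mulrDr.
  by rewrite cos2Dsin2 mulr1.
move: hc hs; rewrite rr'.
move=> /(mulfI (lt0r_neq0 r'0)) hc /(mulfI (lt0r_neq0 r'0)) hs.
have xx' : x = x' by apply: sincos_inj hc hs; exact: bound.
have kt : k%:R + t = k'%:R + t'.
  move: xx'; rewrite /x /x' => /mulfI.
  rewrite mulf_neq0 ?pnatr_eq0 ?lt0r_neq0 ?pi_gt0 //.
  by move=> /(_ isT) /mulIf; rewrite invr_eq0 pnatr_eq0; apply.
have kk' : k = k'.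
  move: t01 t'01 => /andP[t0 t1] /andP[t'0 t'1].
  by case: (ltngtP k k') => //; rewrite -(ler_nat R) -natr1 => ?; exfalso; lra.
split=> //; subst k'.
have tt' : t = t' by lra.
subst t'; apply: (strand_inj (le01 _ t01)).
exact: injective_projections rr' hz.
Qed.

(* The strand in position [j] at the beginning of sector [k] started in
   position [(word_perm (take k w))^-1 j]. *)
Definition cycle_of w (k : nat) j : {set 'I_n} :=
  porbit (word_perm w) ((word_perm (take k w))^-1%g j).

Lemma cycle_of0 w j : cycle_of w 0 j = porbit (word_perm w) j.
Proof. by rewrite /cycle_of take0 /word_perm big_nil invg1 perm1. Qed.

Lemma cycle_of_next w k j :
  cycle_of w k.+1 (piece_perm (onth w k) j) = cycle_of w k j.
Proof. by rewrite /cycle_of word_perm_take invMg permM permK. Qed.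

(** A full turn replaces the starting position by its preimage under [word_perm w], which lies in
    the same cycle. *)
Lemma cycle_of_turn w j : cycle_of w (size w).+1 j = cycle_of w 0 j.
Proof.
rewrite cycle_of0 /cycle_of take_oversize // -(porbit_perm _ 1).
by rewrite expg1 permKV.
Qed.

(** * The piece of the closed braid carried by one cycle *)

Definition strands w (O : {set 'I_n}) : set (R * R * R) :=
  [set p | exists (k : nat) (j : 'I_n) (t : R),
    [/\ (k <= size w)%N, 0 <= t <= 1, cycle_of w k j = O & p = arc w k j t]].

Lemma closed_braid_strands w :
  closed_braid w = \bigcup_(O in [set` porbits (word_perm w)]) strands w O.
Proof.
apply/seteqP; split=> p.
  move=> [k [j [t [kw t01 ->]]]]; exists (cycle_of w k j).
    by apply/imsetP; exists ((word_perm (take k w))^-1%g j).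
  by exists k, j, t.
by move=> [c _ [k [j [t [kw t01 _ ->]]]]]; exists k, j, t.
Qed.

(* The end of an arc is renamed the beginning of the next one, so that the
   parameters of a point are unique. *)
Lemma strands_halfopen w O p : strands w O p ->
  exists k j (t : R),
    [/\ (k <= size w)%N, 0 <= t < 1, cycle_of w k j = O & p = arc w k j t].
Proof.
move=> [k [j [t [kw /andP[t0 t1] <- ->]]]].
have [t1'|t1'] := ltP t 1; first by exists k, j, t; rewrite t0.
have -> : t = 1 by apply/le_anti; rewrite t1.
rewrite arc_next -cycle_of_next; set j' := piece_perm _ _.
have [kw'|wk] := ltnP k (size w).
  by exists k.+1, j', 0; rewrite lexx ltr01.
have -> : k = size w by apply/eqP; rewrite eqn_leq kw.
by exists 0%N, j', 0; rewrite arc_turn cycle_of_turn lexx ltr01.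
Qed.

Lemma strands_disjoint w O O' p : strands w O p -> strands w O' p -> O = O'.
Proof.
move=> /strands_halfopen[k [j [t [kw t01 <- ->]]]].
move=> /strands_halfopen[k' [j' [t' [k'w t'01 <- /arc_inj]]]].
by move=> /(_ kw t01 k'w t'01)[-> ->].
Qed.

Lemma strands_compact w O : compact (strands w O).
Proof.
pose F (x : 'I_(size w).+1 * 'I_n) := arc w x.1 x.2 @` `[0, 1]%classic.
have -> : strands w O =
    \bigcup_(x in [set` [pred x : 'I_(size w).+1 * 'I_n |
                         cycle_of w x.1 x.2 == O]]) F x.
  apply/seteqP; split=> p.
    move=> [k [j [t [kw t01 cO ->]]]]; exists (Ordinal (kw : (k < (size w).+1)%N), j).
      by rewrite /= inE; apply/eqP.
    by exists t => //=; rewrite in_itv.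
  move=> [[k j] /=]; rewrite inE /= => /eqP cO [t].
  rewrite /= in_itv /= => t01 <-.
  by exists k, j, t; rewrite -ltnS.
rewrite bigcup_pred; apply: bigsetU_compact => x _.
apply: continuous_compact; last exact: segment_compact.
by apply: continuous_subspaceT; exact: arc_continuous.
Qed.

Lemma strands_start w j : strands w (cycle_of w 0 j) (arc w 0 j 0).
Proof. by exists 0%N, j, 0; rewrite lexx ler01. Qed.

(** Every point is linked to the start of [arc w 0 j0]: back along its arc, back through the sectors
    to sector 0, then by whole turns, which run through the orbit of [j0]. *)
Lemma strands_connected w j0 : connected (strands w (cycle_of w 0 j0)).
Proof.
set O := cycle_of w 0 j0; set X := strands w O.
pose linked := connected_component X.
have linked_arc k j t : (k <= size w)%N -> cycle_of w k j = O -> 0 <= t <= 1 ->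
    linked (arc w k j 0) (arc w k j t).
  move=> kw cO t01; pose A := arc w k j @` `[0, 1]%classic.
  have Aco : connected A.
    apply: connected_continuous_connected; first exact: segment_connected.
    by apply: continuous_subspaceT; exact: arc_continuous.
  have in01 (s : R) : 0 <= s <= 1 -> A (arc w k j s).
    by move=> s01; exists s => //=; rewrite in_itv.
  suff : A `<=` linked (arc w k j 0) by apply; exact: in01.
  apply: connected_component_max => //.
    by apply: in01; rewrite lexx ler01.
  by move=> _ [s /=] + <-; rewrite in_itv /= => s01; exists k, j, s.
(* The bound includes [(size w).+1], the full turn with its closing sector, on which [linked_iter]
   relies. *)
have linked_start k j : (k <= (size w).+1)%N -> cycle_of w 0 j = O ->
    linked (arc w 0 j 0) (arc w k (word_perm (take k w) j) 0).
  move=> + cO; elim: k => [_|k IH kw].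
    rewrite take0 /word_perm big_nil perm1; apply: connected_component_refl.
    by rewrite /X -cO; exact: strands_start.
  apply: connected_component_trans (IH (ltnW kw)) _.
  rewrite word_perm_take permM -arc_next; apply: linked_arc => //.
    by rewrite -cO cycle_of0 /cycle_of permK.
  by rewrite ler01 lexx.
have linked_iter i :
    linked (arc w 0 j0 0) (arc w 0 ((word_perm w ^+ i)%g j0) 0).
  elim: i => [|i IH].
    by rewrite expg0 perm1; apply: connected_component_refl; exact: strands_start.
  apply: connected_component_trans IH _.
  rewrite expgSr permM -(arc_turn w (word_perm w _)).
  have := @linked_start (size w).+1 ((word_perm w ^+ i)%g j0) (leqnn _).
  by rewrite take_oversize //; apply; rewrite /O !cycle_of0 porbit_perm.
suff -> : X = linked (arc w 0 j0 0) by exact: component_connected.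
apply/seteqP; split; last exact: connected_component_sub.
move=> _ [k [j [t [kw t01 cO ->]]]].
(* [j1] is the position in sector 0 of the strand that reaches position [j] in sector [k]. *)
pose j1 := (word_perm (take k w))^-1%g j.
have cj1 : cycle_of w 0 j1 = O by rewrite cycle_of0 -cO.
apply: connected_component_trans (linked_arc _ _ _ kw cO t01).
have := linked_start k j1 (leqW kw) cj1; rewrite permKV.
apply: connected_component_trans.
have /porbitP[i ->] : j1 \in porbit (word_perm w) j0.
  by rewrite -eq_porbit_mem -!cycle_of0 cj1.
exact: linked_iter.
Qed.

End ClosedBraid.

(** * Transport to [L] along the ambient isotopy *)

Theorem proposition7p2 (R : realType) (n : nat) (beta : braid n)
    (L : set (R * R * R)) (HL : is_closure beta L) :
  markov_trace beta = CoefRing.a ^+ n_components L.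
Proof.
case: HL => w [<- [H [_ Hhom _ HL]]].
have /Hhom : (1 : R) \in `[0, 1]%classic by rewrite inE /= in_itv /= ler01 lexx.
set h := fun x => H (1, x); move=> [hc [g [_ hK _]]].
rewrite markov_traceE; congr (_ ^+ _); apply/esym.
pose F O := h @` @strands R n w O.
have LE : L = \bigcup_(O in [set` porbits (word_perm w)]) F O.
  by rewrite -HL closed_braid_strands image_bigcup.
have hsub (A : set (R * R * R)) : {within A, continuous h}.
  exact: continuous_subspaceT.
rewrite /n_components /components LE; apply: card_components.
(* Closedness of the images comes from compactness in a Hausdorff space. *)
- move=> O _; apply: compact_closed; first exact: norm_hausdorff.
  by apply: continuous_compact => //; exact: strands_compact.
- move=> _ /imsetP[j _ ->]; apply: connected_continuous_connected => //.
  by rewrite -cycle_of0; exact: strands_connected.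
- move=> O O' _ _ _ [p Op <-] [p' Op' /(can_inj hK) pp'].
  by apply: (strands_disjoint Op); rewrite -pp'.
- move=> _ /imsetP[j _ ->]; exists (h (arc w 0 j 0)), (arc w 0 j 0) => //.
  by rewrite -cycle_of0; exact: strands_start.
Qed.
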